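(* Let $(\mathbf{M},g_m)$ and $(\mathbf{B},g_b)$ be semi-Riemannian manifolds with affine connections $\nabla$ on $\mathbf{M}$ and $\nabla^*$ on $\mathbf{B}$, and let $\overline{\nabla}$ and $\overline{\nabla^{*}}$ be the dual connections of $\nabla$ with respect to $g_m$ and of $\nabla^*$ with respect to $g_b$, respectively. Let $\pi:(\mathbf{M},g_m)\to(\mathbf{B},g_b)$ be a conformal submersion. Then $\pi:(\mathbf{M},\nabla)\to(\mathbf{B},\nabla^{*})$ is a conformal submersion with horizontal distribution if and only if $\pi:(\mathbf{M},\overline{\nabla})\to(\mathbf{B},\overline{\nabla^{*}})$ is a conformal submersion with horizontal distribution.
   Context: All objects are smooth. A submersion $\pi:\mathbf{M}\to\mathbf{B}$ is a surjective map with $\pi_{*p}:T_p\mathbf{M}\to T_{\pi(p)}\mathbf{B}$ surjective for all $p$; here $\dim\mathbf{M}>\dim\mathbf{B}$. Put $\mathcal{V}(\mathbf{M})_p=\ker\pi_{*p}$ (vertical subspace) and let $\mathcal{H}(\mathbf{M})_p=\mathcal{V}(\mathbf{M})_p^{\perp}$ be its $g_m$-orthogonal complement (horizontal subspace), with $T_p\mathbf{M}=\mathcal{V}(\mathbf{M})_p\oplus\mathcal{H}(\mathbf{M})_p$ for all $p$ (this is part of the notion of horizontal distribution; it is automatic in the Riemannian case). $\mathcal{H}$ and $\mathcal{V}$ also denote the projections onto the horizontal and vertical subspaces. $\mathcal{X}(\mathbf{B})$ is the set of vector fields on $\mathbf{B}$; for $X\in\mathcal{X}(\mathbf{B})$,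 $\tilde X$ is its unique horizontal lift to $\mathbf{M}$. A submersion $\pi:(\mathbf{M},g_m)\to(\mathbf{B},g_b)$ is a conformal submersion if there is $\phi\in C^\infty(\mathbf{M})$ with $g_m(X,Y)=e^{2\phi}g_b(\pi_*X,\pi_*Y)$ for all horizontal vector fields $X,Y$ on $\mathbf{M}$. Given such $\pi$ and $\phi$, and affine connections $\nabla$ on $\mathbf{M}$ and $\nabla^*$ on $\mathbf{B}$ (not necessarily Levi-Civita), $\pi:(\mathbf{M},\nabla)\to(\mathbf{B},\nabla^* )$ is a conformal submersion with horizontal distribution if for all $X,Y\in\mathcal{X}(\mathbf{B})$ $$\mathcal{H}(\nabla_{\tilde X}\tilde Y)=\widetilde{(\nabla^*_XY)}+\tilde X(\phi)\tilde Y+\tilde Y(\phi)\tilde X-\mathcal{H}(\mathrm{grad}_\pi\phi)\,g_m(\tilde X,\tilde Y),$$ where $\mathrm{grad}_\pi\phi$ is the gradient of $\phi$ with respect to $g_m$. For a (semi-)Riemannian manifold $(\mathbf{M},g)$ with affine connection $\nabla$, the dual connection $\overline{\nabla}$ is defined by $Xg(Y,Z)=g(\nabla_XY,Z)+g(Y,\overline{\nabla}_XZ)$ for all vector fields $X,Y,Z$. *)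

(* Defs.v *)
From mathcomp Require Import all_boot all_order all_algebra.
From mathcomp Require Import all_classical all_reals all_analysis.
Import numFieldNormedType.Exports.

Set Implicit Arguments.
Unset Strict Implicit.
Unset Printing Implicit Defensive.

Import Order.TTheory GRing.Theory Num.Theory.
Local Open Scope classical_set_scope.
Local Open Scope ring_scope.

(* [Ck k A f] is meant for open [A] and finite-dimensional [V], where it says
   that [f] is k times continuously differentiable on [A]. *)
Fixpoint Ck (R : realType) (V W : normedModType R) (k : nat)
    (A : set V) (f : V -> W) : Prop :=
  match k with
  | 0 => forall x, A x -> {for x, continuous f}
  | k'.+1 => (forall x, A x -> differentiable f x) /\
             (forall v, Ck k' A (fun x => 'd f x v))
  end.

Definition smooth_on (R : realType) (V W : normedModType R)
  (A : set V) (f : V -> W) : Prop := forall k, Ck k A f.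

(* The values of [chart_map] off [chart_dom], and of [chart_inv] off the image
   of [chart_dom], are irrelevant. *)
Record chart (R : realType) (n : nat) (T : topologicalType) := Chart {
  chart_dom : set T;
  chart_map :> T -> 'rV[R]_n;
  chart_inv : 'rV[R]_n -> T;
  chart_dom_open : open chart_dom;
  chart_img_open : open (chart_map @` chart_dom);
  chart_mapK : forall p, chart_dom p -> chart_inv (chart_map p) = p;
  chart_map_continuous : forall p, chart_dom p ->
    {for p, continuous chart_map};
  chart_inv_continuous : forall x, (chart_map @` chart_dom) x ->
    {for x, continuous chart_inv}
}.

(* Smooth manifolds of dimension [n], without boundary. The atlas need not be
   maximal; [chart_at p] is a preferred chart around [p]. *)
Record manifold (R : realType) (n : nat) := Manifold {
  manifold_space :> topologicalType;
  atlas : set (chart R n manifold_space);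
  chart_at : manifold_space -> chart R n manifold_space;
  chart_at_atlas : forall p, atlas (chart_at p);
  chart_at_dom : forall p, chart_dom (chart_at p) p;
  atlas_compatible : forall c d, atlas c -> atlas d ->
    smooth_on (c @` (chart_dom c `&` chart_dom d)) (d \o chart_inv c);
  manifold_hausdorff : hausdorff_space manifold_space;
  manifold_second_countable : @second_countable manifold_space
}.

Section Calculus.
Context (R : realType).

(* A tangent vector at [p] is represented by its coordinates in the preferred
   chart at [p]; [tangent_coord] gives its coordinates in any other chart. *)
Definition tangent n (M : manifold R n) (p : M) := 'rV[R]_n.

Definition tangent_coord n (M : manifold R n) (c : chart R n M) (p : M)
    (v : tangent p) : 'rV[R]_n :=
  'd (c \o chart_inv (chart_at p)) (chart_at p p) v.

Definition smooth_fun n (M : manifold R n) (f : M -> R) : Prop :=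
  forall c, atlas c -> smooth_on (c @` chart_dom c) (f \o chart_inv c).

Definition smooth_map n m (M : manifold R n) (B : manifold R m)
    (F : M -> B) : Prop :=
  continuous F /\
  forall c d, atlas c -> atlas d ->
    smooth_on (c @` (chart_dom c `&` F @^-1` chart_dom d))
              (d \o F \o chart_inv c).

(* Not assumed to be smooth: see [smooth_field]. *)
Definition vector_field n (M : manifold R n) := forall p : M, tangent p.

Definition smooth_field n (M : manifold R n) (X : vector_field M) : Prop :=
  forall c : chart R n M, atlas c ->
    smooth_on (c @` chart_dom c)
      (fun x => tangent_coord c (X (chart_inv c x))).

Definition dfun n (M : manifold R n) (f : M -> R) (p : M) (v : tangent p) : R :=
  'd (f \o chart_inv (chart_at p)) (chart_at p p) v.

Definition dmap n m (M : manifold R n) (B : manifold R m) (F : M -> B)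
    (p : M) (v : tangent p) : tangent (F p) :=
  'd (chart_at (F p) \o F \o chart_inv (chart_at p)) (chart_at p p) v.

(* The function [X f]. *)
Definition lie n (M : manifold R n) (X : vector_field M) (f : M -> R)
    (p : M) : R :=
  dfun f (X p).

End Calculus.

(* Index of a symmetric bilinear form: the largest dimension of a subspace on
   which it is negative definite. *)
Definition has_index (R : realType) (n : nat)
    (b : 'rV[R]_n -> 'rV[R]_n -> R) (k : nat) : Prop :=
  let negdef (W : {vspace 'rV[R]_n}) :=
    forall v, v \in W -> v != 0 -> b v v < 0 in
  (exists W, negdef W /\ \dim W = k) /\
  (forall W, negdef W -> (\dim W <= k)%N).

Record semi_riemannian_metric (R : realType) (n : nat) (M : manifold R n) :=
    Metric {
  metric_form :> forall p : M, tangent p -> tangent p -> R;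
  metric_linear : forall (p : M) (u : tangent p), scalar (metric_form u);
  metric_sym : forall (p : M) (u v : tangent p),
    metric_form u v = metric_form v u;
  metric_nondegenerate : forall (p : M) (u : tangent p),
    (forall v : tangent p, metric_form u v = 0) -> u = 0;
  metric_smooth : forall X Y : vector_field M,
    smooth_field X -> smooth_field Y ->
    smooth_fun (fun p => metric_form (X p) (Y p));
  metric_index : exists k, forall p : M, has_index (@metric_form p) k
}.

(* Connections act on smooth vector fields; their values on other fields are
   irrelevant. *)
Record connection (R : realType) (n : nat) (M : manifold R n) := Connection {
  nabla :> vector_field M -> vector_field M -> vector_field M;
  nabla_smooth : forall X Y, smooth_field X -> smooth_field Y ->
    smooth_field (nabla X Y);
  nablaDl : forall X X' Y,
    smooth_field X -> smooth_field X' -> smooth_field Y ->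
    forall p, nabla (fun q => X q + X' q) Y p = nabla X Y p + nabla X' Y p;
  nablaZl : forall f X Y,
    smooth_fun f -> smooth_field X -> smooth_field Y ->
    forall p, nabla (fun q => f q *: X q) Y p = f p *: nabla X Y p;
  nablaDr : forall X Y Y',
    smooth_field X -> smooth_field Y -> smooth_field Y' ->
    forall p, nabla X (fun q => Y q + Y' q) p = nabla X Y p + nabla X Y' p;
  nabla_leibniz : forall f X Y,
    smooth_fun f -> smooth_field X -> smooth_field Y ->
    forall p, nabla X (fun q => f q *: Y q) p =
              lie X f p *: Y p + f p *: nabla X Y p
}.

Section Submersions.
Context (R : realType).

(* [D'] is the dual of the connection [D] with respect to [g]; it is unique,
   as [g] is nondegenerate. *)
Definition dual_connection n (M : manifold R n) (g : semi_riemannian_metric M)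
    (D D' : connection M) : Prop :=
  forall X Y Z : vector_field M,
  smooth_field X -> smooth_field Y -> smooth_field Z ->
  forall p : M,
    lie X (fun q => g q (Y q) (Z q)) p =
    g p (D X Y p) (Z p) + g p (Y p) (D' X Z p).

(* Here and in [hproj] and [hlift], the set given to [xget] has exactly one
   element (for the last two, when [pi] is a submersion satisfying
   [horizontal_splitting]), and [xget] returns that element. *)
Definition grad n (M : manifold R n) (g : semi_riemannian_metric M)
    (f : M -> R) : vector_field M :=
  fun p => xget 0 [set w : 'rV[R]_n | forall v : tangent p, g p w v = dfun f v].

Variables (n m : nat) (M : manifold R n) (B : manifold R m).
Variables (gM : semi_riemannian_metric M) (gB : semi_riemannian_metric B).
Variable pi : M -> B.

Definition submersion : Prop :=
  [/\ (m < n)%N,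
      smooth_map pi,
      (forall b : B, exists p : M, pi p = b)
    & forall (p : M) (w : tangent (pi p)), exists v : tangent p, dmap pi v = w].

Definition vertical (p : M) (v : tangent p) : Prop := dmap pi v = 0.

Definition horizontal (p : M) (h : tangent p) : Prop :=
  forall v : tangent p, vertical v -> gM p h v = 0.

(* Every tangent space is the direct sum of its vertical and horizontal
   subspaces. *)
Definition horizontal_splitting : Prop :=
  forall p : M,
    (forall u : tangent p, exists v h : tangent p,
        [/\ vertical v, horizontal h & u = v + h]) /\
    (forall u : tangent p, vertical u -> horizontal u -> u = 0).

Definition hproj (p : M) (u : tangent p) : tangent p :=
  xget 0 [set h : 'rV[R]_n |
    @horizontal p h /\ exists v : tangent p, vertical v /\ u = v + h].

Definition hlift (X : vector_field B) : vector_field M :=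
  fun p => xget 0 [set h : 'rV[R]_n |
    @horizontal p h /\ @dmap R n m M B pi p h = X (pi p)].

(* The conformal factor is [expR (2 * phi)]. *)
Definition conformal_submersion (phi : M -> R) : Prop :=
  [/\ submersion,
      horizontal_splitting,
      smooth_fun phi
    & forall X Y : vector_field M, smooth_field X -> smooth_field Y ->
      (forall p, horizontal (X p)) -> (forall p, horizontal (Y p)) ->
      forall p, gM p (X p) (Y p) =
        expR (2 * phi p) * gB (pi p) (dmap pi (X p)) (dmap pi (Y p))].

(* To be used for [pi] and [phi] such that [conformal_submersion phi]. *)
Definition conformal_submersion_with_horizontal_distribution (phi : M -> R)
    (D : connection M) (Ds : connection B) : Prop :=
  forall X Y : vector_field B, smooth_field X -> smooth_field Y ->
  forall p : M,
    hproj (D (hlift X) (hlift Y) p) =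
      hlift (Ds X Y) p
      + lie (hlift X) phi p *: hlift Y p
      + lie (hlift Y) phi p *: hlift X p
      - gM p (hlift X p) (hlift Y p) *: hproj (grad gM phi p).

End Submersions.

(* Main.v *)
From HB Require Import structures.
Require Import Defs.
From mathcomp Require Import all_boot all_order all_algebra.
From mathcomp Require Import all_classical all_reals all_analysis.
From mathcomp Require Import ring lra.
Import numFieldNormedType.Exports.

Set Implicit Arguments.
Unset Strict Implicit.
Unset Printing Implicit Defensive.

Import Order.TTheory GRing.Theory Num.Theory.
Local Open Scope classical_set_scope.
Local Open Scope ring_scope.

(** Write [~X] for the horizontal lift of a field [X] on the base. On lifts, the
    metric of the total space is [expR (2 * phi)] times the pullback of the
    metric of the base, whence (lemma [lie_metric_hlift])

      ~X gM(~Y, ~Z) = 2 ~X(phi) gM(~Y, ~Z) + expR (2 * phi) (X gB(Y, Z)) o pi.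

    Expand the left side by the duality of the two connections of the total
    space, and X gB(Y, Z) by that of the two connections of the base. Pairing
    the defining identity for D_~X ~Y with ~Z produces the terms

      ~X(phi) gM(~Y, ~Z) + ~Y(phi) gM(~X, ~Z) - ~Z(phi) gM(~X, ~Y),

    and subtracting them from 2 ~X(phi) gM(~Y, ~Z) leaves the same expression
    with Y and Z exchanged, which is the pairing of the defining identity for
    Dbar_~X ~Z with ~Y. Since the vectors ~Y p exhaust the horizontal space at
    p, on which the metric is nondegenerate, the identity for Dbar follows
    ([conformal_dual]). Duality being symmetric, so is the statement.

    This computation rests on two facts of differential topology. Connections,
    duality and conformality only concern smooth fields on the whole manifold,
    so lifts of smooth fields have to be smooth ([smooth_hlift]), and a tangent
    vector of the base has to extend to a smooth field ([vector_extension]).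
    The extension multiplies a coordinate field by a bump function built from
    exp(-1/x). As for lifts, their coordinates solve a linear system with smooth
    coefficients, which the splitting makes invertible; the coefficients of the
    metric in a chart are themselves seen to be smooth by evaluating the metric
    on fields cut off by bump functions ([smooth_metric_coef]). *)

(** * Functions of class C^k on open sets *)

Lemma near_eq_is_diff (R : numFieldType) (V W : normedModType R)
    (f g : V -> W) (x : V) :
  (\near x, f x = g x) -> differentiable f x -> is_diff x g ('d f x).
Proof.
move=> fg df.
have fg0 : \forall y \near (0 : V), f (y + x) = g (y + x).
  rewrite (near_shift x) sub0r.
  by near=> y; rewrite /= addrNK; near: y.
have gE : g \o shift x = cst (g x) + 'd f x +o_ 0 id.
  have /eqaddoP fo := diff_locally df.
  apply/eqaddoP => e e0; near=> y.
  rewrite -(nbhs_singleton fg) /=.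
  have -> : (g \o shift x - (cst (f x) + 'd f x)) y =
            (f \o shift x - (cst (f x) + 'd f x)) y.
    rewrite !fctE /=; congr (_ - _); apply/esym.
    by near: y.
  by near: y; exact: fo.
have dE : 'd g x = 'd f x :> (V -> W).
  by apply: diff_unique gE; exact: diff_continuous.
split=> //; apply/diff_locallyP; rewrite dE; split=> //.
exact: diff_continuous.
Unshelve. all: by end_near. Qed.

Lemma is_diff_expR (R : realType) (y : R) :
  is_diff y (@expR R) (fun t => t * expR y).
Proof.
have dE : differentiable (@expR R) y.
  by apply/derivable1_diffP; case: (is_derive_expR y).
split=> //; rewrite diff1E// derive1E.
by rewrite (derive_val (is_derive := is_derive_expR y)).
Qed.

Section CkTheory.
Context (R : realType).
Implicit Types (V W : normedModType R) (k : nat).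

Lemma Ck_subset V W k (A B : set V) (f : V -> W) :
  B `<=` A -> Ck k A f -> Ck k B f.
Proof.
elim: k f => [|k IH] f BA /=; first by move=> h x /BA; exact: h.
by move=> [h1 h2]; split=> [x /BA/h1//|v]; exact: IH.
Qed.

(** Both continuity and the differential at [x] are properties of the germ of [f],
    taken in the whole space [V]. *)
Lemma Ck_local V W k (A : set V) (f : V -> W) :
  (forall x, A x -> exists2 U, U x & Ck k U f) -> Ck k A f.
Proof.
elim: k f => [|k IH] f h /=; first by move=> x /h [U Ux]; exact.
split=> [x /h [U Ux [dU _]]|v]; first exact: dU.
by apply: IH => x /h [U Ux [_ hU]]; exists U => //; exact: hU.
Qed.

(** Openness of [A] makes the germs of [f] and [g] agree, hence also their
    differentials. Most closure properties below are obtained by rewriting the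
    differential through this lemma and then by induction on [k]. *)
Lemma Ck_eq V W k (A : set V) (f g : V -> W) : open A ->
  (forall x, A x -> f x = g x) -> Ck k A f -> Ck k A g.
Proof.
move=> Ao; elim: k f g => [|k IH] f g fg.
  move=> /= fc x Ax; suff : g y @[y --> x] --> f x by rewrite fg.
  apply: cvg_trans (fc x Ax); apply: near_eq_cvg.
  by near=> y; apply: fg; near: y; exact: open_nbhs_nbhs.
move=> [df ddf].
have dg x : A x -> is_diff x g ('d f x).
  move=> Ax; apply: near_eq_is_diff; last exact: df.
  by near=> y; apply: fg; near: y; exact: open_nbhs_nbhs.
split=> [x /dg[]//|v]; by apply: IH (ddf v) => x /dg[_ ->].
Unshelve. all: by end_near. Qed.

Lemma CkS V W k (A : set V) (f : V -> W) : Ck k.+1 A f -> Ck k A f.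
Proof.
elim: k f => [|k IH] f [h1 h2]; first by move=> x /h1/differentiable_continuous.
by split=> // v; apply: IH; exact: h2.
Qed.

Lemma smooth_differentiable V W (A : set V) (f : V -> W) x :
  smooth_on A f -> A x -> differentiable f x.
Proof. by move=> /(_ 1%N)[df _] /df. Qed.

Lemma Ck_cst V W k (A : set V) (a : W) : open A -> Ck k A (cst a).
Proof.
move=> Ao; elim: k a => [|k IH] a /=.
  by move=> x _; exact: cst_continuous.
split=> [x _|v]; first exact: differentiable_cst.
by apply: (Ck_eq Ao _ (IH 0)) => x Ax; rewrite diff_cst.
Qed.

Lemma Ck_linear V W k (A : set V) (f : {linear V -> W}) :
  open A -> continuous f -> Ck k A f.
Proof.
move=> Ao fc; case: k => [|k]; first by move=> x _; exact: fc.
split=> [x _|v]; first exact: linear_differentiable.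
by apply: (Ck_eq Ao _ (Ck_cst k (f v) Ao)) => x Ax; rewrite diff_lin.
Qed.

Lemma Ck_lcomp V W W' k (A : set V) (L : {linear W -> W'}) (f : V -> W) :
  open A -> continuous L -> Ck k A f -> Ck k A (L \o f).
Proof.
move=> Ao Lc; elim: k f => [|k IH] f.
  move=> /= fc x Ax; apply: continuous_comp; first exact: fc.
  exact: Lc.
move=> [df ddf]; have dL y : differentiable L y by exact: linear_differentiable.
split=> [x Ax|v]; first by apply: differentiable_comp; [exact: df|].
apply: (Ck_eq Ao _ (IH _ (ddf v))) => x Ax /=.
by rewrite (diff_comp (df x Ax) (dL _)) /= diff_lin.
Qed.

Lemma CkD V W k (A : set V) (f g : V -> W) : open A ->
  Ck k A f -> Ck k A g -> Ck k A (fun x => f x + g x).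
Proof.
move=> Ao; elim: k f g => [|k IH] f g.
  by move=> /= hf hg x Ax; apply: continuousD; [exact: hf|exact: hg].
move=> [df ddf] [dg ddg]; split=> [x Ax|v].
  by apply: differentiableD; [exact: df|exact: dg].
apply: (Ck_eq Ao _ (IH _ _ (ddf v) (ddg v))) => x Ax.
by rewrite [in RHS](diffD (df x Ax) (dg x Ax)).
Qed.

Lemma Ck_sum V W k (A : set V) (I : Type) (r : seq I) (P : pred I)
    (f : I -> V -> W) : open A -> (forall i, Ck k A (f i)) ->
  Ck k A (fun x => \sum_(i <- r | P i) f i x).
Proof.
move=> Ao h; elim: r => [|i r IH].
  by apply: (Ck_eq Ao _ (Ck_cst k 0 Ao)) => x _; rewrite big_nil.
apply: (Ck_eq Ao (f := fun x => (if P i then f i x else 0) +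
    \sum_(i <- r | P i) f i x)).
  by move=> x _; rewrite big_cons; case: (P i); rewrite ?add0r.
by apply: CkD => //; case: (P i) => //; exact: Ck_cst.
Qed.

Lemma CkM V k (A : set V) (f g : V -> R) : open A ->
  Ck k A f -> Ck k A g -> Ck k A (fun x => f x * g x).
Proof.
move=> Ao; elim: k f g => [|k IH] f g.
  by move=> /= hf hg x Ax; apply: continuousM; [exact: hf|exact: hg].
move=> hf hg; have [df ddf] := hf; have [dg ddg] := hg; split=> [x Ax|v].
  by apply: differentiableM; [exact: df|exact: dg].
apply: (Ck_eq Ao (f := fun x => f x * 'd g x v + g x * 'd f x v)).
  by move=> x Ax; rewrite [in RHS](diffM (df x Ax) (dg x Ax)).
exact: (CkD Ao (IH _ _ (CkS hf) (ddg v)) (IH _ _ (CkS hg) (ddf v))).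
Qed.

Lemma Ck_prod V k (A : set V) (I : Type) (r : seq I) (P : pred I)
    (f : I -> V -> R) : open A -> (forall i, Ck k A (f i)) ->
  Ck k A (fun x => \prod_(i <- r | P i) f i x).
Proof.
move=> Ao h; elim: r => [|i r IH].
  by apply: (Ck_eq Ao _ (Ck_cst k (1 : R) Ao)) => x _; rewrite big_nil.
apply: (Ck_eq Ao (f := fun x => (if P i then f i x else 1) *
    \prod_(i <- r | P i) f i x)).
  by move=> x _; rewrite big_cons; case: (P i); rewrite ?mul1r.
by apply: CkM => //; case: (P i) => //; exact: Ck_cst.
Qed.

Lemma CkZl V W k (A : set V) (f : V -> R) (w : W) : open A ->
  Ck k A f -> Ck k A (fun x => f x *: w).
Proof.
move=> Ao; elim: k f => [|k IH] f.
  move=> /= hf x Ax; apply: (@continuous_comp _ _ _ f ( *:%R ^~ w)).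
    exact: hf.
  exact: scalel_continuous.
move=> [df ddf]; split=> [x Ax|v].
  by apply: differentiableZl; exact: df.
apply: (Ck_eq Ao _ (IH _ (ddf v))) => x Ax.
by rewrite [in RHS](diffZl w (df x Ax)).
Qed.

Lemma Ck_mxcoord V n m k (A : set V) (f : V -> 'M[R]_(n, m)) i j :
  open A -> Ck k A f -> Ck k A (fun x => f x i j).
Proof.
move=> Ao fk.
have lin : linear (fun N : 'M[R]_(n, m) => N i j : R).
  by move=> a u v; rewrite !mxE.
pose L : {linear 'M[R]_(n, m) -> R} :=
  HB.pack (fun N : 'M[R]_(n, m) => N i j : R)
    (GRing.isLinear.Build _ _ _ _ _ lin).
by apply: (@Ck_lcomp _ _ _ _ _ L) => //; exact: coord_continuous.
Qed.

(** A row vector is the combination of the fixed vectors [delta_mx 0 i] with its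
    coordinates as coefficients. *)
Lemma Ck_row V n k (A : set V) (f : V -> 'rV[R]_n) : open A ->
  (forall i, Ck k A (fun x => f x 0 i)) -> Ck k A f.
Proof.
move=> Ao fk; apply: (Ck_eq Ao (f := fun x => \sum_i f x 0 i *: delta_mx 0 i)).
  by move=> x _; rewrite -row_sum_delta.
by apply: Ck_sum => // i; exact: CkZl.
Qed.

(** The chain rule expresses the differential of [g \o f] through those of [g]
    and [f]; expanding the inner one in a basis turns the composite into sums
    of products of functions to which induction applies. The basis is a
    parameter, so as to cover both [R] and [R^n] as intermediate space. *)
Lemma Ck_comp_basis V V' n (e : 'I_n -> V') (c : 'I_n -> {linear V' -> R})
    k (A : set V) (B : set V') (f : V -> V') (g : V' -> R) :
  (forall i, continuous (c i)) -> (forall v, v = \sum_i c i v *: e i) ->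
  open A -> open B -> (forall x, A x -> B (f x)) ->
  Ck k A f -> Ck k B g -> Ck k A (g \o f).
Proof.
move=> cc ce Ao Bo fAB; elim: k g => [|k IH] g.
  move=> /= hf hg x Ax; apply: continuous_comp; first exact: hf.
  exact/hg/fAB.
move=> hf [dg ddg]; have [df ddf] := hf; split=> [x Ax|v].
  by apply: differentiable_comp; [exact: df|exact: dg (fAB _ Ax)].
apply: (Ck_eq Ao (f := fun x => \sum_i c i ('d f x v) * 'd g (f x) (e i))).
  move=> x Ax; rewrite (diff_comp (df x Ax) (dg _ (fAB x Ax))) /=.
  rewrite [in RHS](ce ('d f x v)) linear_sum; apply: eq_bigr => i _.
  by rewrite linearZ.
apply: Ck_sum => // i; apply: CkM => //; first exact: Ck_lcomp (ddf v).
exact: (IH (fun y => 'd g y (e i)) (CkS hf) (ddg _)).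
Qed.

Lemma Ck_comp1 V k (A : set V) (B : set R) (f : V -> R) (g : R -> R) :
  open A -> open B -> (forall x, A x -> B (f x)) ->
  Ck k A f -> Ck k B g -> Ck k A (g \o f).
Proof.
apply: (@Ck_comp_basis V R 1 (fun=> 1) (fun=> idfun)) => [_ x|v].
  exact: cvg_id.
by rewrite big_ord1 /= [RHS]mulr1.
Qed.

Lemma Ck_comp V n k (A : set V) (B : set 'rV[R]_n) (f : V -> 'rV[R]_n)
    (g : 'rV[R]_n -> R) :
  open A -> open B -> (forall x, A x -> B (f x)) ->
  Ck k A f -> Ck k B g -> Ck k A (g \o f).
Proof.
have lin j : linear (fun N : 'rV[R]_n => N 0 j : R).
  by move=> a u v; rewrite !mxE.
pose L j : {linear 'rV[R]_n -> R} :=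
  HB.pack (fun N : 'rV[R]_n => N 0 j : R)
    (GRing.isLinear.Build _ _ _ _ _ (lin j)).
apply: (@Ck_comp_basis V 'rV[R]_n n (delta_mx 0) L).
  by move=> i; exact: coord_continuous.
by move=> v; rewrite [LHS]row_sum_delta.
Qed.

Lemma Ck_rcomp V n m k (A : set V) (B : set 'rV[R]_n) (f : V -> 'rV[R]_n)
    (g : 'rV[R]_n -> 'rV[R]_m) :
  open A -> open B -> (forall x, A x -> B (f x)) ->
  Ck k A f -> Ck k B g -> Ck k A (g \o f).
Proof.
move=> Ao Bo fAB fk gk; apply: Ck_row => // i.
by apply: (Ck_comp Ao Bo fAB fk (g := fun y => g y 0 i)); exact: Ck_mxcoord.
Qed.

(** The differential of the inverse of [f] is [- (f x)^-1 ^+ 2] times that of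
    [f], so that products and the induction hypothesis suffice. *)
Lemma Ck_inv V k (A : set V) (f : V -> R) : open A ->
  (forall x, A x -> f x != 0) -> Ck k A f -> Ck k A (fun x => (f x)^-1).
Proof.
move=> Ao f0; elim: k => [|k IH].
  by move=> /= hf x Ax; apply: continuousV; [exact: f0|exact: hf].
move=> hf; have [df ddf] := hf; split=> [x Ax|v].
  by apply: differentiableV; [exact: df|exact: f0].
apply: (Ck_eq Ao (f := fun x => (-1) * ((f x)^-1 * (f x)^-1) * 'd f x v)).
  move=> x Ax; rewrite [RHS](congr1 (@^~ v) (diffV (df x Ax) (f0 x Ax))) /=.
  by rewrite mulN1r expr2 invfM.
have fk := IH (CkS hf).
exact: CkM Ao (CkM Ao (Ck_cst k (-1 : R) Ao) (CkM Ao fk fk)) (ddf v).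
Qed.

Lemma Ck_det V n k (A : set V) (f : V -> 'M[R]_n) : open A ->
  (forall i j, Ck k A (fun x => f x i j)) -> Ck k A (fun x => \det (f x)).
Proof.
move=> Ao fk; apply: Ck_sum => // s; apply: CkM => //; first exact: Ck_cst.
exact: Ck_prod.
Qed.

(** By Cramer's rule the entries are polynomials in the entries of [f], divided
    by the determinant. *)
Lemma Ck_invmx V n k (A : set V) (f : V -> 'M[R]_n) : open A ->
  (forall x, A x -> f x \in unitmx) ->
  (forall i j, Ck k A (fun x => f x i j)) ->
  forall i j, Ck k A (fun x => invmx (f x) i j).
Proof.
move=> Ao fu fk i j.
apply: (Ck_eq Ao (f := fun x => (\det (f x))^-1 * cofactor (f x) j i)).
  by move=> x Ax; rewrite /invmx fu// !mxE.
apply: CkM => //.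
  by apply: Ck_inv => //; [move=> x /fu; rewrite unitmxE unitfE|exact: Ck_det].
apply: CkM => //; first exact: Ck_cst.
apply: Ck_det => // a b.
by apply: (Ck_eq Ao _ (fk (lift j a) (lift i b))) => x Ax; rewrite !mxE.
Qed.

End CkTheory.

(** * A smooth bump function supported in a cube *)

Section Bump.
Context (R : realType).

(** The powers of [x^-1] make this family stable under differentiation. *)
Definition flat (k : nat) (x : R) : R :=
  if 0 < x then x^-1 ^+ k * expR (- x^-1) else 0.

(** From [t ^+ k.+2 / k.+2`! <= expR t] at [t = x^-1]: the quadratic bound makes
    the derivative at 0 exist and vanish. *)
Lemma flat_le (k : nat) (x : R) : `|flat k x| <= k.+2`!%:R * x ^+ 2.
Proof.
rewrite /flat; case: ifPn => [x0|_]; last first.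
  by rewrite normr0 mulr_ge0// ?ler0n// sqr_ge0.
have t0 : 0 < x^-1 by rewrite invr_gt0.
rewrite ger0_norm ?mulr_ge0 ?expR_ge0 ?exprn_ge0 ?(ltW t0)//.
rewrite expRN ler_pdivrMr ?expR_gt0//.
have f0 : (0 : R) < k.+2`!%:R by rewrite ltr0n fact_gt0.
have := expR_ge1Dxn k.+1 (ltW t0).
rewrite addrC -lerBrDr => h.
have {}h : x^-1 ^+ k.+2 / k.+2`!%:R <= expR x^-1.
  by apply: le_trans h _; rewrite gerBl.
rewrite ler_pdivrMr// in h.
have -> : x^-1 ^+ k = x ^+ 2 * x^-1 ^+ k.+2.
  by rewrite !exprS expr0; field; rewrite gt_eqF.
by rewrite -[leRHS]mulrA [leRHS]mulrCA ler_wpM2l ?sqr_ge0// mulrC.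
Qed.

Lemma is_derive_flat (k : nat) (x : R) :
  is_derive x 1 (flat k) (- k%:R * flat k.+1 x + flat k.+2 x).
Proof.
have [x0|x0|->] := ltgtP x 0.
- apply: (@near_eq_is_derive _ _ _ (cst 0)); last first.
    by rewrite /flat !ltNge !(ltW x0)/= mulr0 addr0; exact: is_derive_cst.
  near=> y; rewrite /flat ifF//; apply/negbTE; rewrite -leNgt ltW//.
  by near: y; exact: lt_nbhsl.
- apply: (@near_eq_is_derive _ _ _ (fun y : R => y^-1 ^+ k * expR (- y^-1))).
    near=> y; rewrite /flat ifT//.
    by near: y; exact: lt_nbhsr.
  rewrite /flat x0.
  have dV : is_derive x 1 (fun y : R => y^-1) (- x ^- 2 *: 1).
    by apply: is_deriveV; rewrite gt_eqF.
  have dX : is_derive x 1 (fun y : R => y^-1 ^+ k) (- k%:R * x^-1 ^+ k.+1).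
    case: k => [|k].
      rewrite oppr0 mul0r; under eq_fun do rewrite expr0.
      exact: is_derive_cst.
    have H := is_deriveX k.+1 dV; rewrite exprfctE in H.
    apply: (is_derive_eq H).
    by rewrite /GRing.scale /= !exprS; field; rewrite gt_eqF.
  have dE : is_derive x 1 (fun y : R => expR (- y^-1)) (x ^- 2 * expR (- x^-1)).
    have dN : is_derive x 1 (fun y : R => - y^-1) (x ^- 2).
      apply: (is_derive_eq (is_deriveN dV)).
      by rewrite /GRing.scale /= mulr1 opprK.
    have H := @is_derive1_comp _ expR (fun y : R => - y^-1) x _ _
      (is_derive_expR _) dN.
    apply: (is_derive_eq H).
    by rewrite mulrC.
  apply: (is_derive_eq (is_deriveM dX dE)).
  by rewrite /GRing.scale /= !exprS; field; rewrite gt_eqF.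
- have flat0 j : flat j 0 = 0 by rewrite /flat ltxx.
  rewrite !flat0 mulr0 addr0.
  have fcvg : h^-1 *: ((flat k \o shift 0) (h *: 1) - flat k 0)
      @[h --> (0 : R)^'] --> (0 : R).
    apply/cvgr0Pnorm_le => e e0; near=> h.
    rewrite flat0 subr0 /= addr0 /GRing.scale /= mulr1 normrM normfV.
    have h0 : 0 < `|h| by rewrite normr_gt0; near: h; exact: nbhs_dnbhs_neq.
    rewrite mulrC ler_pdivrMr// (le_trans (flat_le k h))//.
    rewrite -real_normK ?num_real// expr2 mulrA ler_wpM2r// mulrC.
    rewrite -ler_pdivlMr ?ltr0n ?fact_gt0//; near: h.
    by apply: dnbhs0_le; rewrite divr_gt0// ltr0n fact_gt0.
  by apply: DeriveDef; [apply/cvg_ex; exists 0|exact/cvg_lim].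
Unshelve. all: by end_near. Qed.

Lemma Ck_flat (k j : nat) : Ck j setT (flat k).
Proof.
have df i x : differentiable (flat i) x.
  by apply/derivable1_diffP; case: (is_derive_flat i x).
elim: j k => [|j IH] k; first by move=> x _; exact: differentiable_continuous.
split=> // v.
apply: (Ck_eq openT (f := fun x => (- k%:R * flat k.+1 x + flat k.+2 x) * v)).
  move=> x _; rewrite (diff1E (df k x)) derive1E.
  by rewrite (derive_val (is_derive := is_derive_flat k x)) mulrC.
apply: CkM; [exact: openT| |exact/Ck_cst/openT].
apply: CkD; [exact: openT| |exact: IH].
by apply: CkM; [exact: openT|exact/Ck_cst/openT|exact: IH].
Qed.

(** The factor of index [i] is nonzero exactly when the [i]-th coordinates of
    [x] and [a] are less than [r] apart. *)
Definition cube_bump n (a : 'rV[R]_n) (r : R) (x : 'rV[R]_n) : R :=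
  \prod_i (flat 0 (r + (x 0 i - a 0 i)) * flat 0 (r - (x 0 i - a 0 i))).

Lemma Ck_cube_bump n (a : 'rV[R]_n) (r : R) k (A : set 'rV[R]_n) :
  open A -> Ck k A (cube_bump a r).
Proof.
move=> Ao.
have xk i : Ck k A (fun x : 'rV[R]_n => x 0 i - a 0 i).
  apply: CkD => //; last exact: Ck_cst.
  exact: (Ck_mxcoord _ _ Ao (@Ck_linear _ _ _ k A idfun Ao (fun=> cvg_id))).
apply: Ck_prod => // i; apply: CkM => //.
  apply: (Ck_comp1 Ao openT _ _ (Ck_flat 0 k)) => //.
  by apply: CkD => //; exact: Ck_cst.
apply: (Ck_comp1 Ao openT _ _ (Ck_flat 0 k)) => //.
apply: CkD => //; first exact: Ck_cst.
apply: (Ck_eq Ao (f := fun x : 'rV[R]_n => -1 * (x 0 i - a 0 i))).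
  by move=> x _; rewrite mulN1r.
by apply: CkM => //; exact: Ck_cst.
Qed.

Lemma cube_bump_neq0 n (a : 'rV[R]_n) (r : R) (x : 'rV[R]_n) :
  (cube_bump a r x != 0) = [forall i, `|x 0 i - a 0 i| < r].
Proof.
have flat_neq0 y : (flat 0 y != 0) = (0 < y).
  rewrite /flat; case: ifPn => _; last by rewrite eqxx.
  by rewrite expr0 mul1r gt_eqF// expR_gt0.
have absE y : (0 < r + y) && (0 < r - y) = (`|y| < r).
  by rewrite ltr_norml subr_gt0 -ltrBlDl sub0r.
rewrite prodf_seq_neq0; apply/allP/forallP => h i; have := h i;
  rewrite ?mem_index_enum// mulf_eq0 negb_or !flat_neq0 absE//.
exact.
Qed.

End Bump.

(** * Charts, tangent vectors and the chain rule *)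

Section Charts.
Context (R : realType).

Lemma chart_image_open n (T : topologicalType) (c : chart R n T) (U : set T) :
  open U -> open (c @` (chart_dom c `&` U)).
Proof.
move=> Uo; rewrite openE => _ [p [pc pU] <-] /=.
have cp : (c @` chart_dom c) (c p) by exists p.
have h1 : \forall y \near c p, (c @` chart_dom c) y.
  by apply: open_nbhs_nbhs; split=> //; exact: chart_img_open.
have h2 : \forall y \near c p, U (chart_inv c y).
  apply: (chart_inv_continuous cp); rewrite chart_mapK//.
  exact: open_nbhs_nbhs.
near=> y; have [q qc qy] : (c @` chart_dom c) y by near: y.
exists q => //; split=> //; rewrite -(chart_mapK qc) qy; near: y; exact: h2.
Unshelve. all: by end_near. Qed.

Lemma open_dom_preimage n (T T' : topologicalType) (d : chart R n T')
    (F : T -> T') : continuous F -> open (F @^-1` chart_dom d).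
Proof. by move=> /continuousP; apply; exact: chart_dom_open. Qed.

(** Only the germ at [p] matters: near [c p], [h \o F] read in [c] is
    [h] read in [d] composed with [F] read in [c] and [d]. *)
Lemma is_diff_chart_comp n m (T T' : topologicalType) (W : normedModType R)
    (c : chart R n T) (d : chart R m T') (F : T -> T') (h : T' -> W) (p : T) :
  chart_dom c p -> chart_dom d (F p) -> {for p, continuous F} ->
  differentiable (d \o F \o chart_inv c) (c p) ->
  differentiable (h \o chart_inv d) (d (F p)) ->
  is_diff (c p) (h \o F \o chart_inv c)
    ('d (h \o chart_inv d) (d (F p)) \o 'd (d \o F \o chart_inv c) (c p)).
Proof.
move=> pc pd Fp dF dh.
have dh' : differentiable (h \o chart_inv d) ((d \o F \o chart_inv c) (c p)).
  by rewrite /= chart_mapK.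
have dhF := differentiable_comp dF dh'.
have nE : \forall y \near c p,
    ((h \o chart_inv d) \o (d \o F \o chart_inv c)) y =
    (h \o F \o chart_inv c) y.
  have cp : (c @` chart_dom c) (c p) by exists p.
  have : \forall y \near c p, chart_dom d (F (chart_inv c y)).
    have : {for c p, continuous (F \o chart_inv c)}.
      apply: continuous_comp; first exact: chart_inv_continuous.
      by rewrite chart_mapK.
    apply; rewrite /= chart_mapK//; apply: open_nbhs_nbhs; split=> //.
    exact: chart_dom_open.
  by apply: filterS => y yd /=; rewrite (chart_mapK yd).
have := near_eq_is_diff nE dhF.
by rewrite (diff_comp dF dh') /= chart_mapK.
Qed.

End Charts.

Section Tangent.
Context (R : realType) (n : nat) (M : manifold R n).
Implicit Types (c d : chart R n M) (p : M).

Lemma differentiable_transition c d p : atlas c -> atlas d ->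
  chart_dom c p -> chart_dom d p -> differentiable (d \o chart_inv c) (c p).
Proof.
move=> ac ad pc pd; apply: (smooth_differentiable (atlas_compatible ac ad)).
by exists p.
Qed.

(** The case of the identity map: differentials read in two charts differ by
    the differential of the transition map. *)
Lemma diff_chart_change (W : normedModType R) (h : M -> W) c d p v :
  atlas c -> atlas d -> chart_dom c p -> chart_dom d p ->
  differentiable (h \o chart_inv d) (d p) ->
  'd (h \o chart_inv c) (c p) v =
  'd (h \o chart_inv d) (d p) ('d (d \o chart_inv c) (c p) v).
Proof.
move=> ac ad pc pd dh.
have [_ E] := is_diff_chart_comp (F := id) pc pd (fun=> id)
  (differentiable_transition ac ad pc pd) dh.
exact: (congr1 (@^~ v) E).
Qed.

(** The tangent vector at [p] with coordinates [w] in the chart [c]; inverse of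
    [tangent_coord c] when [p] lies in the domain of [c]. *)
Definition tangent_vec c p (w : 'rV[R]_n) : tangent p :=
  'd (chart_at p \o chart_inv c) (c p) w.

Lemma diff_chart_id c p v : chart_dom c p -> 'd (c \o chart_inv c) (c p) v = v.
Proof.
move=> pc; have nE : \forall y \near c p, id y = (c \o chart_inv c) y.
  have : \forall y \near c p, (c @` chart_dom c) y.
    by apply: open_nbhs_nbhs; split; [exact: chart_img_open|exists p].
  by apply: filterS => _ [q qc <-] /=; rewrite chart_mapK.
have [_ ->] := near_eq_is_diff nE (ex_diff (is_diff_def := is_diff_id (c p))).
by rewrite (diff_val (is_diff_def := is_diff_id (c p))).
Qed.

Lemma tangent_coord_vec c d p w : atlas c -> atlas d ->
  chart_dom c p -> chart_dom d p ->
  tangent_coord d (tangent_vec c p w) = 'd (d \o chart_inv c) (c p) w.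
Proof.
move=> ac ad pc pd; rewrite /tangent_coord /tangent_vec.
have aP := chart_at_atlas p; have pP := chart_at_dom p.
exact: esym (diff_chart_change w ac aP pc pP
  (differentiable_transition aP ad pP pd)).
Qed.

Lemma tangent_vecK c p : atlas c -> chart_dom c p ->
  cancel (tangent_vec c p) (@tangent_coord R n M c p).
Proof.
by move=> ac pc w; rewrite tangent_coord_vec// diff_chart_id.
Qed.

Lemma tangent_coordK c p : atlas c -> chart_dom c p ->
  cancel (@tangent_coord R n M c p) (tangent_vec c p).
Proof.
move=> ac pc w; rewrite /tangent_coord /tangent_vec.
have aP := chart_at_atlas p; have pP := chart_at_dom p.
rewrite -[RHS](diff_chart_id w pP).
exact: esym (diff_chart_change w aP ac pP pc
  (differentiable_transition ac aP pc pP)).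
Qed.

Lemma tangent_vecD c p u v :
  tangent_vec c p (u + v) = tangent_vec c p u + tangent_vec c p v.
Proof. by rewrite /tangent_vec linearD. Qed.

Lemma tangent_vecZ c p k v :
  tangent_vec c p (k *: v) = k *: tangent_vec c p v.
Proof. by rewrite /tangent_vec linearZ. Qed.

Lemma tangent_coordZ c p k (v : tangent p) :
  tangent_coord c (k *: v : tangent p) = k *: tangent_coord c v.
Proof. by rewrite /tangent_coord linearZ. Qed.

Lemma tangent_coord0 c p : tangent_coord c (0 : tangent p) = 0.
Proof. by rewrite /tangent_coord linear0. Qed.

Lemma dfun_linear (f : M -> R) p : scalar (@dfun R n M f p).
Proof. by move=> a u v; rewrite /dfun linearP. Qed.

Lemma smooth_fun_differentiable (f : M -> R) c p :
  smooth_fun f -> atlas c -> chart_dom c p ->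
  differentiable (f \o chart_inv c) (c p).
Proof.
by move=> fs ac pc; apply: (smooth_differentiable (fs c ac)); exists p.
Qed.

End Tangent.

Section Maps.
Context (R : realType) (n m : nat) (M : manifold R n) (B : manifold R m).
Variables (F : M -> B).
Hypothesis Fs : smooth_map F.

Lemma differentiable_map_chart c d (p : M) : atlas c -> atlas d ->
  chart_dom c p -> chart_dom d (F p) ->
  differentiable (d \o F \o chart_inv c) (c p).
Proof.
move=> ac ad pc pd; apply: (smooth_differentiable (Fs.2 c d ac ad)).
by exists p.
Qed.

(** [dmap] is defined through the preferred charts; this computes it in an
    arbitrary pair of charts. *)
Lemma tangent_coord_dmap c d (p : M) (v : tangent p) : atlas c -> atlas d ->
  chart_dom c p -> chart_dom d (F p) ->
  tangent_coord d (dmap F v) =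
  'd (d \o F \o chart_inv c) (c p) (tangent_coord c v).
Proof.
move=> ac ad pc pd; rewrite /tangent_coord /dmap.
have aP := chart_at_atlas p; have pP := chart_at_dom p.
have aF := chart_at_atlas (F p); have pF := chart_at_dom (F p).
apply: etrans (diff_chart_change v aP ac pP pc
  (differentiable_map_chart ac ad pc pd)).
have [_ E] := is_diff_chart_comp pP pF (@Fs.1 p)
  (differentiable_map_chart aP aF pP pF)
  (differentiable_transition aF ad pF pd).
exact: esym (congr1 (@^~ v) E).
Qed.

Lemma is_diff_pullback (f : B -> R) (p : M) : smooth_fun f ->
  is_diff (chart_at p p) (f \o F \o chart_inv (chart_at p))
    (fun v => dfun f (@dmap R n m M B F p v)).
Proof.
move=> fs; have aP := chart_at_atlas p; have pP := chart_at_dom p.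
have aF := chart_at_atlas (F p); have pF := chart_at_dom (F p).
exact: (is_diff_chart_comp pP pF (@Fs.1 p)
  (differentiable_map_chart aP aF pP pF) (smooth_fun_differentiable fs aF pF)).
Qed.

End Maps.

(** * Global smooth fields with prescribed values *)

Section Metric.
Context (R : realType) (n : nat) (M : manifold R n).
Variables (g : semi_riemannian_metric M) (p : M).
Implicit Types u v w : tangent p.

Lemma metricZr k u v : g p u (k *: v) = k * g p u v.
Proof.
have g0 : g p u 0 = 0.
  by have /eqP := metric_linear g u 1 0 0;
    rewrite scaler0 addr0 mul1r -subr_eq0 opprD addNKr oppr_eq0 => /eqP.
by have := metric_linear g u k v 0; rewrite addr0 g0 addr0.
Qed.

Lemma metricDr u v w : g p u (v + w) = g p u v + g p u w.
Proof. by have := metric_linear g u 1 v w; rewrite scale1r mul1r. Qed.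

Lemma metricNr u v : g p u (- v) = - g p u v.
Proof. by rewrite -scaleN1r metricZr mulN1r. Qed.

Lemma metricZl k u v : g p (k *: u) v = k * g p u v.
Proof. by rewrite Defs.metric_sym metricZr Defs.metric_sym. Qed.

Lemma metricDl u v w : g p (u + v) w = g p u w + g p v w.
Proof. by rewrite Defs.metric_sym metricDr !(Defs.metric_sym g w). Qed.

Lemma metric_sumr (I : finType) (f : I -> tangent p) u :
  g p u (\sum_i f i) = \sum_i g p u (f i).
Proof.
apply: (big_morph (g p u)); first exact: metricDr.
by rewrite -(scale0r (0 : tangent p)) metricZr mul0r.
Qed.

Lemma metric_suml (I : finType) (f : I -> tangent p) u :
  g p (\sum_i f i) u = \sum_i g p (f i) u.
Proof.
rewrite Defs.metric_sym metric_sumr; apply: eq_bigr => i _.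
exact: Defs.metric_sym.
Qed.

End Metric.

Section BumpField.
Context (R : realType) (n : nat) (M : manifold R n).
Implicit Types (c d : chart R n M) (p : M).

Definition closed_cube (a : 'rV[R]_n) (r : R) : set 'rV[R]_n :=
  [set x | forall i, `|x 0 i - a 0 i| <= r].

Lemma closed_cube_compact a r : compact (closed_cube a r).
Proof.
rewrite (_ : closed_cube a r =
    [set x : 'rV[R]_n | forall i, `[a 0 i - r, a 0 i + r]%classic (x 0 i)]).
  apply: (rV_compact (A := fun i => `[a 0 i - r, a 0 i + r]%classic)) => i.
  exact: segment_compact.
by apply/seteqP; split=> x /= h i; have := h i;
  rewrite in_itv /= ler_distl.
Qed.

Lemma open_cube (a : 'rV[R]_n) r : 0 < r -> open [set x | cube_bump a r x != 0].
Proof.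
move=> r0; rewrite (_ : [set x | _] = ball a r); first exact: ball_open.
apply/seteqP; split=> x /=; rewrite cube_bump_neq0.
  by move=> /forallP h; split=> // i j; rewrite ord1 /ball /= distrC.
by move=> [_ h]; apply/forallP => i; have := h 0 i; rewrite /ball /= distrC.
Qed.

(** The radius is halved because the cube is closed while balls are open. *)
Lemma cube_in_open (A : set 'rV[R]_n) a : open A -> A a ->
  exists2 r, 0 < r & closed_cube a r `<=` A.
Proof.
move=> Ao Aa; have /nbhs_ballP[e /= e0 eA] : nbhs a A by exact: open_nbhs_nbhs.
exists (e / 2); first by rewrite divr_gt0.
move=> x xa; apply: eA; split=> // i j; rewrite ord1 /ball /= distrC.
by apply: le_lt_trans (xa j) _; rewrite ltr_pdivrMr// ltr_pMr// ltr1n.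
Qed.

(** A coordinate field of [c], cut off by a bump function and extended by 0
    outside the domain of [c]. *)
Definition bump_field c (a : 'rV[R]_n) (r : R) (w : 'rV[R]_n) :
    vector_field M :=
  fun p => if `[< chart_dom c p >] then cube_bump a r (c p) *: tangent_vec c p w
           else 0.

Lemma bump_fieldE c a r w p : chart_dom c p ->
  bump_field c a r w p = cube_bump a r (c p) *: tangent_vec c p w.
Proof. by move=> pc; rewrite /bump_field asboolT. Qed.

(** Away from the domain of [c] the field vanishes identically, because the
    cube, being compact in a Hausdorff space, is closed in the manifold. *)
Lemma smooth_bump_field c a r w : atlas c ->
  closed_cube a r `<=` c @` chart_dom c -> smooth_field (bump_field c a r w).
Proof.
move=> ac cube d ad k; apply: Ck_local => _ [q qd <-].
have [qc|qc] := pselect (chart_dom c q).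
  exists (d @` (chart_dom d `&` chart_dom c)); first by exists q.
  have Uo := chart_image_open (c := d) (chart_dom_open c).
  have Co := chart_image_open (c := c) (chart_dom_open d).
  pose t := c \o chart_inv d.
  have tk : Ck k (d @` (chart_dom d `&` chart_dom c)) t.
    exact: atlas_compatible.
  apply: (Ck_eq Uo (f := fun y => \sum_i
      (cube_bump a r (t y) * ('d (d \o chart_inv c) (t y) w) 0 i) *:
      delta_mx 0 i)).
    move=> _ [p [pd pc] <-]; rewrite /t /= !chart_mapK// bump_fieldE//.
    rewrite tangent_coordZ tangent_coord_vec//.
    by rewrite [in RHS](row_sum_delta ('d _ _ _)) scaler_sumr;
      apply: eq_bigr => i _; rewrite scalerA.
  have tU y : (d @` (chart_dom d `&` chart_dom c)) y ->
      (c @` (chart_dom c `&` chart_dom d)) (t y).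
    by move=> [p [pd pc] <-]; exists p => //; rewrite /t /= chart_mapK.
  apply: Ck_sum => // i; apply: CkZl => //; apply: CkM => //.
    exact: (Ck_comp Uo Co tU tk (Ck_cube_bump _ _ _ Co)).
  apply: (Ck_comp Uo Co tU tk (g := fun y => ('d (d \o chart_inv c) y w) 0 i)).
  have [_ dk] := atlas_compatible ac ad k.+1.
  exact: Ck_mxcoord (dk w).
pose K := chart_inv c @` closed_cube a r.
have Kcl : closed K.
  apply: (compact_closed (@manifold_hausdorff _ _ M)).
  apply: continuous_compact (closed_cube_compact (a := a) (r := r)).
  apply: continuous_in_subspaceT => y /set_mem /cube.
  exact: chart_inv_continuous.
have Ko : open (~` K) by exact: closed_openC.
exists (d @` (chart_dom d `&` ~` K)).
  exists q => //; split=> // -[y /cube [p pc <-]]; rewrite chart_mapK// => pq.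
  by apply: qc; rewrite -pq.
have Uo := chart_image_open (c := d) Ko.
apply: (Ck_eq Uo _ (Ck_cst k 0 Uo)) => _ [p [pd pK] <-].
rewrite chart_mapK// /bump_field; case: asboolP => pc; last first.
  by rewrite tangent_coord0.
suff -> : cube_bump a r (c p) = 0 by rewrite scale0r tangent_coord0.
apply/eqP; apply: contra_notT pK; rewrite cube_bump_neq0 => /forallP h.
by exists (c p); [move=> i; rewrite ltW|rewrite chart_mapK].
Qed.

(** At the centre of the cube the bump function is nonzero, and [w] can be
    divided by its value there. *)
Lemma vector_extension p (w : tangent p) :
  exists2 X : vector_field M, smooth_field X & X p = w.
Proof.
pose c := chart_at p; have ac := chart_at_atlas p; have pc := chart_at_dom p.
have [r r0 rc] : exists2 r, 0 < r & closed_cube (c p) r `<=` c @` chart_dom c.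
  by apply: cube_in_open; [exact: chart_img_open|exists p].
pose b := cube_bump (c p) r (c p).
have b0 : b != 0.
  by rewrite cube_bump_neq0; apply/forallP => i; rewrite subrr normr0.
exists (bump_field c (c p) r (b^-1 *: tangent_coord c w)).
  exact: smooth_bump_field.
rewrite bump_fieldE// tangent_vecZ scalerA divff// scale1r.
exact: tangent_coordK.
Qed.

Variable g : semi_riemannian_metric M.

Definition metric_coef c (u v x : 'rV[R]_n) : R :=
  g (chart_inv c x) (tangent_vec c (chart_inv c x) u)
    (tangent_vec c (chart_inv c x) v).

(** Smoothness of a metric is expressed with global fields; near a point the
    coordinate fields agree, up to a nonvanishing smooth factor, with bump
    fields, which are global. *)
Lemma smooth_metric_coef c u v : atlas c ->
  smooth_on (c @` chart_dom c) (metric_coef c u v).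
Proof.
move=> ac k; apply: Ck_local => a ca.
have Co := @chart_img_open _ _ _ c.
have [r r0 rc] := cube_in_open Co ca.
pose b := cube_bump a r.
pose U := [set x | b x != 0].
have Uo : open U by exact: open_cube.
have UC x : U x -> (c @` chart_dom c) x.
  move=> Ux; apply: rc => i; apply: ltW.
  by move: Ux; rewrite /U /= cube_bump_neq0 => /forallP.
exists U; first by rewrite /U /= cube_bump_neq0; apply/forallP => i;
  rewrite subrr normr0.
pose E w := bump_field c a r w.
apply: (Ck_eq Uo (f := fun x => (b x)^-1 * (b x)^-1 *
   ((fun p => g p (E u p) (E v p)) \o chart_inv c) x)).
  move=> x Ux; have [p pc px] := UC x Ux.
  rewrite /= /metric_coef -px chart_mapK// /E !bump_fieldE// px.
  rewrite metricZl metricZr.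
  by rewrite -mulrA !mulKf.
have bk : Ck k U (fun x => (b x)^-1).
  by apply: Ck_inv => //; exact: Ck_cube_bump.
apply: CkM => //; first exact: CkM.
apply: (Ck_subset UC).
have Es w : smooth_field (E w) by exact: smooth_bump_field.
exact: (@metric_smooth _ _ _ g _ _ (Es u) (Es v) c ac k).
Qed.

End BumpField.

(** * Gradients and horizontal lifts *)

Section Riesz.
Context (R : realType) (n : nat) (M : manifold R n).
Variables (g : semi_riemannian_metric M).

(** Stated for a linear parametrization [f] of the tangent space, so as to cover
    the standard basis as well as the coordinate basis of a chart. *)
Lemma metric_mulmx (p : M)
  (f : 'rV[R]_n -> tangent p) (a b : 'rV[R]_n) :
  (forall u v, f (u + v) = f u + f v) -> (forall k u, f (k *: u) = k *: f u) ->
  g p (f a) (f b) =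
  (a *m (\matrix_(i, j) g p (f (delta_mx 0 i)) (f (delta_mx 0 j))) *m b^T) 0 0.
Proof.
move=> fD fZ.
have fE u : f u = \sum_i u 0 i *: f (delta_mx 0 i).
  rewrite {1}(row_sum_delta u) (big_morph f fD (id1 := 0)).
    by apply: eq_bigr => i _; rewrite fZ.
  by have := fZ 0 0; rewrite !scale0r.
rewrite (fE a) (fE b) metric_sumr mxE; apply: eq_bigr => j _.
rewrite metricZr metric_suml !mxE mulrC; congr (_ * _).
by apply: eq_bigr => i _; rewrite metricZl !mxE.
Qed.

(** The Gram matrix of a nondegenerate form is invertible. *)
Lemma metric_riesz (p : M) (L : tangent p -> R) :
  scalar L -> exists w : tangent p, forall v, g p w v = L v.
Proof.
move=> Ll.
have L0 : L 0 = 0.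
  have := Ll 1 0 0; rewrite scaler0 addr0 mul1r => /eqP.
  by rewrite -subr_eq0 opprD addNKr oppr_eq0 => /eqP.
have LD u v : L (u + v) = L u + L v by have := Ll 1 u v; rewrite scale1r mul1r.
have LZ k u : L (k *: u) = k * L u by have := Ll k u 0; rewrite L0 !addr0.
pose G := \matrix_(i, j) g p (delta_mx 0 i) (delta_mx 0 j).
have gG (u v : tangent p) : g p u v = (u *m G *m v^T) 0 0.
  exact: (@metric_mulmx p id).
have Gu : G \in unitmx.
  rewrite -row_free_unit; apply: inj_row_free => u uG.
  by apply: (@metric_nondegenerate _ _ _ g p) => v; rewrite gG uG mul0mx mxE.
exists ((\row_j L (delta_mx 0 j)) *m invmx G) => v.
rewrite gG mulmxKV// mxE [in RHS](row_sum_delta v) (big_morph L LD L0).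
by apply: eq_bigr => j _; rewrite !mxE LZ mulrC.
Qed.

Lemma metric_grad (f : M -> R) (p : M) (v : tangent p) :
  g p (grad g f p) v = dfun f v.
Proof.
rewrite /grad; case: xgetP => [w _ + //|none].
have [w gw] := metric_riesz (@dfun_linear _ _ M f p).
by case: (none w).
Qed.

End Riesz.

Section Horizontal.
Context (R : realType) (n m : nat) (M : manifold R n) (B : manifold R m).
Variables (g : semi_riemannian_metric M) (pi : M -> B).
Hypotheses (pi_sub : submersion pi) (pi_split : horizontal_splitting g pi).
Implicit Types (p : M) (X : vector_field B).

Local Notation horizontal := (@horizontal R n m M B g pi _).
Local Notation vertical := (@vertical R n m M B pi _).

Lemma dmapD p (u v : tangent p) :
  dmap pi (u + v : tangent p) = dmap pi u + dmap pi v.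
Proof. by rewrite /dmap linearD. Qed.

Lemma dmapB p (u v : tangent p) :
  dmap pi (u - v : tangent p) = dmap pi u - dmap pi v.
Proof. by rewrite /dmap linearB. Qed.

Lemma horizontalD p (u v : tangent p) :
  horizontal u -> horizontal v -> horizontal (u + v : tangent p).
Proof. by move=> hu hv w vw; rewrite metricDl hu// hv// addr0. Qed.

Lemma horizontalZ p k (u : tangent p) :
  horizontal u -> horizontal (k *: u : tangent p).
Proof. by move=> hu w vw; rewrite metricZl hu// mulr0. Qed.

Lemma horizontalB p (u v : tangent p) :
  horizontal u -> horizontal v -> horizontal (u - v : tangent p).
Proof. by move=> hu hv; rewrite -scaleN1r; apply/horizontalD/horizontalZ. Qed.

(** The difference [u - v] is both vertical and horizontal. *)
Lemma horizontal_eq p (u v : tangent p) :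
  horizontal u -> horizontal v -> dmap pi u = dmap pi v -> u = v.
Proof.
move=> hu hv uv; apply/eqP; rewrite -subr_eq0; apply/eqP.
apply: (pi_split p).2; last exact: horizontalB.
by rewrite /Defs.vertical dmapB uv subrr.
Qed.

(** The horizontal part of any preimage of [X (pi p)] is a lift. *)
Lemma hliftP X p :
  horizontal (hlift g pi X p) /\ dmap pi (hlift g pi X p) = X (pi p).
Proof.
rewrite /hlift; case: xgetP => [w _ //|none].
have [_ _ _ /(_ p (X (pi p)))[u uX]] := pi_sub.
have [v [h [vv hh uvh]]] := (pi_split p).1 u.
by case: (none h); split=> //; rewrite -uX uvh dmapD vv add0r.
Qed.

Lemma hlift_unique X p (h : tangent p) :
  horizontal h -> dmap pi h = X (pi p) -> h = hlift g pi X p.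
Proof.
move=> hh hX; have [lh lX] := hliftP X p.
by apply: horizontal_eq => //; rewrite lX.
Qed.

Lemma hprojP p (u : tangent p) : horizontal (hproj g pi u) /\
  exists v : tangent p, vertical v /\ u = v + hproj g pi u.
Proof.
rewrite /hproj; case: xgetP => [w _ //|none].
have [v [h [vv hh uvh]]] := (pi_split p).1 u.
by case: (none h); split=> //; exists v.
Qed.

(** The vertical part of [u] is orthogonal to [h]. *)
Lemma metric_hproj p (h u : tangent p) :
  horizontal h -> g p h (hproj g pi u) = g p h u.
Proof.
move=> hh; have [_ [v [vv {2}->]]] := hprojP u.
by rewrite metricDr (hh v vv) add0r.
Qed.

(** Vertical vectors, to which [u] is orthogonal by definition, and horizontal
    ones together span the tangent space. *)
Lemma horizontal_nondegenerate p (u : tangent p) : horizontal u ->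
  (forall h : tangent p, horizontal h -> g p h u = 0) -> u = 0.
Proof.
move=> hu u0; apply: (@metric_nondegenerate _ _ _ g p) => w.
have [v [h [vv hh ->]]] := (pi_split p).1 w.
by rewrite metricDr (hu v vv) add0r Defs.metric_sym u0.
Qed.

(** In coordinates the horizontal lift [a] of a vector [w] solves the linear
    system [a *m J = w], [a *m G = - y *m J^T] for some multiplier [y]: the
    second equation says that [a] is orthogonal to the kernel of the Jacobian
    [J] for the Gram matrix [G]. *)
Definition lift_system (c : chart R n M) (d : chart R m B) (x : 'rV[R]_n) :
    'M[R]_(n + m) :=
  let J := 'J (d \o pi \o chart_inv c) x in
  block_mx (\matrix_(i, j) metric_coef g c (delta_mx 0 i) (delta_mx 0 j) x) J
           J^T 0.

Section LiftSystem.
Variables (c : chart R n M) (d : chart R m B) (p : M).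
Hypotheses (ac : atlas c) (ad : atlas d).
Hypotheses (pc : chart_dom c p) (pd : chart_dom d (pi p)).

Let G := \matrix_(i, j) metric_coef g c (delta_mx 0 i) (delta_mx 0 j) (c p).
Let J := 'J (d \o pi \o chart_inv c) (c p).

Let dmapJ a : tangent_coord d (dmap pi (tangent_vec c p a)) = a *m J.
Proof.
have [_ pis _ _] := pi_sub.
by rewrite (tangent_coord_dmap pis _ ac ad pc pd) tangent_vecK// mul_rV_lin1.
Qed.

Let metricG a b : g p (tangent_vec c p a) (tangent_vec c p b) =
  (a *m G *m b^T) 0 0.
Proof.
have -> : G = \matrix_(i, j) g p (tangent_vec c p (delta_mx 0 i))
    (tangent_vec c p (delta_mx 0 j)).
  apply/matrixP => i j.
  by rewrite [LHS]mxE [RHS]mxE /metric_coef (chart_mapK pc).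
by apply: metric_mulmx => *; [exact: tangent_vecD|exact: tangent_vecZ].
Qed.

Let vecE (v : tangent p) : v = tangent_vec c p (tangent_coord c v).
Proof. by rewrite tangent_coordK. Qed.

Let horizontal_system a y : a *m G + y *m J^T = 0 ->
  horizontal (tangent_vec c p a).
Proof.
move=> aG v vv; rewrite (vecE v) metricG.
have vJ : tangent_coord c v *m J = 0.
  by rewrite -dmapJ -vecE vv tangent_coord0.
have -> : a *m G = - (y *m J^T) by apply/eqP; rewrite -addr_eq0 aG.
by rewrite mulNmx -mulmxA -trmx_mul vJ trmx0 mulmx0 oppr0 mxE.
Qed.

Let mul_system (a : 'rV_n) (y : 'rV_m) :
  row_mx a y *m lift_system c d (c p) = row_mx (a *m G + y *m J^T) (a *m J).
Proof. by rewrite mul_row_block mulmx0 addr0. Qed.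

(** If [(a, y)] is in the kernel, then [a] is both vertical and horizontal, so
    it vanishes; then [y] is orthogonal to the range of [J], which is everything
    because the projection is a submersion. *)
Lemma lift_system_unit : lift_system c d (c p) \in unitmx.
Proof.
rewrite -row_free_unit; apply: inj_row_free => v.
rewrite -[v]hsubmxK; set a := lsubmx v; set y := rsubmx v.
rewrite mul_system -[0]hsubmxK !linear0 => /eq_row_mx[aG aJ].
have a0 : a = 0.
  rewrite -(tangent_vecK ac pc a) -[RHS](tangent_coord0 c p).
  congr tangent_coord.
  apply: (pi_split p).2; last exact: horizontal_system aG.
  apply: (can_inj (tangent_coordK ad pd)).
  by rewrite dmapJ aJ tangent_coord0.
suff -> : y = 0 by rewrite a0 row_mx0.
move: aG; rewrite a0 mul0mx add0r => yJ; apply/rowP => j.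
have [_ _ _ /(_ p (tangent_vec d (pi p) (delta_mx 0 j)))[v' v'j]] := pi_sub.
have := dmapJ (tangent_coord c v'); rewrite -vecE v'j tangent_vecK// => jE.
have : y *m (delta_mx 0 j : 'rV_m)^T = 0.
  by rewrite jE trmx_mul mulmxA yJ mul0mx.
by rewrite trmx_delta -colE => /matrixP/(_ 0 0); rewrite !mxE.
Qed.

Lemma tangent_coord_hlift X : tangent_coord c (hlift g pi X p) =
  lsubmx (row_mx 0 (tangent_coord d (X (pi p))) *m
          invmx (lift_system c d (c p))).
Proof.
set s := _ *m _; have sE : s *m lift_system c d (c p) =
    row_mx 0 (tangent_coord d (X (pi p))).
  by rewrite mulmxKV// lift_system_unit.
move: sE; rewrite -{1}[s]hsubmxK mul_system => /eq_row_mx[sG sJ].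
rewrite -[RHS](tangent_vecK ac pc); congr tangent_coord; apply/esym.
apply: hlift_unique; first exact: horizontal_system sG.
by apply: (can_inj (tangent_coordK ad pd)); rewrite dmapJ sJ.
Qed.

End LiftSystem.

(** Near each point the coordinates of the lift solve [lift_system], whose
    entries are smooth, so Cramer's rule applies. *)
Lemma smooth_hlift X : smooth_field X -> smooth_field (hlift g pi X).
Proof.
move=> Xs c ac k; apply: Ck_local => _ [q qc <-].
have [_ pis _ _] := pi_sub.
pose d := chart_at (pi q); have ad : atlas d by exact: chart_at_atlas.
have qd : chart_dom d (pi q) by exact: chart_at_dom.
pose U := c @` (chart_dom c `&` pi @^-1` chart_dom d).
have Uo : open U by exact/chart_image_open/open_dom_preimage/pis.1.
exists U; first by exists q.
have Us : smooth_on U (d \o pi \o chart_inv c) by exact: pis.2.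
pose x := fun y => tangent_coord d (X (pi (chart_inv c y))).
have xk : Ck k U x.
  apply: (Ck_eq Uo (f := (fun z => tangent_coord d (X (chart_inv d z))) \o
      (d \o pi \o chart_inv c))).
    by move=> _ [p [pc pd] <-]; rewrite /x /= chart_mapK// chart_mapK.
  apply: (Ck_rcomp Uo (@chart_img_open _ _ _ d) _ (Us k) (Xs d ad k)).
  by move=> _ [p [pc pd] <-]; exists (pi p); rewrite //= chart_mapK.
apply: (Ck_eq Uo (f := fun y =>
    lsubmx (row_mx 0 (x y) *m invmx (lift_system c d y)))).
  move=> _ [p [pc pd] <-].
  by rewrite /x chart_mapK// -tangent_coord_hlift.
apply: Ck_row => // i.
apply: (Ck_eq Uo (f := fun y => \sum_l row_mx 0 (x y) 0 l *
    invmx (lift_system c d y) l (lshift m i))).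
  by move=> y _; rewrite !mxE.
have Jk i' j : Ck k U (fun y => 'J (d \o pi \o chart_inv c) y i' j).
  have [_ /(_ (delta_mx 0 i')) dk] := Us k.+1.
  apply: (Ck_eq Uo _ (Ck_mxcoord 0 j Uo dk)) => y _.
  by rewrite /jacobian /lin1_mx mxE.
apply: Ck_sum => // l; apply: CkM => //.
  case: (split_ordP l) => j ->.
    by apply: (Ck_eq Uo _ (Ck_cst k (0 : R) Uo)) => y _; rewrite row_mxEl mxE.
  by apply: (Ck_eq Uo _ (Ck_mxcoord 0 j Uo xk)) => y _; rewrite row_mxEr.
apply: Ck_invmx => // [_ [p [pc pd] <-]|]; first exact: lift_system_unit.
move=> a b; case: (split_ordP a) => a' ->; case: (split_ordP b) => b' ->.
- have UC : U `<=` c @` chart_dom c by move=> _ [p [pc _] <-]; exists p.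
  apply: (Ck_eq Uo _ (Ck_subset UC
    (smooth_metric_coef g (delta_mx 0 a') (delta_mx 0 b') ac k))) => y _.
  by rewrite block_mxEul mxE.
- by apply: (Ck_eq Uo _ (Jk a' b')) => y _; rewrite block_mxEur.
- by apply: (Ck_eq Uo _ (Jk b' a')) => y _; rewrite block_mxEdl [RHS]mxE.
- by apply: (Ck_eq Uo _ (Ck_cst k (0 : R) Uo)) => y _; rewrite block_mxEdr mxE.
Qed.

End Horizontal.

(** * Conformal submersions and dual connections *)

Section Duality.
Context (R : realType) (n m : nat) (M : manifold R n) (B : manifold R m).
Variables (gM : semi_riemannian_metric M) (gB : semi_riemannian_metric B).
Variables (pi : M -> B) (phi : M -> R).
Hypothesis hpi : conformal_submersion gM gB pi phi.

Let pi_sub : submersion pi. Proof. by case: hpi. Qed.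
Let pi_split : horizontal_splitting gM pi. Proof. by case: hpi. Qed.
Let phi_smooth : smooth_fun phi. Proof. by case: hpi. Qed.

Local Notation lift := (hlift gM pi).

Let lift_horizontal X p : horizontal gM pi (lift X p).
Proof. by case: (hliftP pi_sub pi_split X p). Qed.

Let dmap_lift X p : dmap pi (lift X p) = X (pi p).
Proof. by case: (hliftP pi_sub pi_split X p). Qed.

Let lift_smooth X : smooth_field X -> smooth_field (lift X).
Proof. exact: smooth_hlift. Qed.

Lemma metric_hlift X Y p : smooth_field X -> smooth_field Y ->
  gM p (lift X p) (lift Y p) =
  expR (2 * phi p) * gB (pi p) (X (pi p)) (Y (pi p)).
Proof.
move=> Xs Ys; have [_ _ _ ->] := hpi; rewrite ?dmap_lift//;
  exact: lift_smooth.
Qed.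

(** [metric_hlift] turns the function on the left into the product of
    [expR (2 * phi)] and a function pulled back from the base, along whose
    projection [lift X] is related to [X]. *)
Lemma lie_metric_hlift X Y Z p :
  smooth_field X -> smooth_field Y -> smooth_field Z ->
  lie (lift X) (fun q => gM q (lift Y q) (lift Z q)) p =
  2 * lie (lift X) phi p * gM p (lift Y p) (lift Z p) +
  expR (2 * phi p) * lie X (fun b => gB b (Y b) (Z b)) (pi p).
Proof.
move=> Xs Ys Zs; rewrite metric_hlift//.
under [X in lie _ X]eq_fun do rewrite metric_hlift//.
rewrite /lie; move: (dmap_lift X p); move: (lift X p) => v vX.
pose c := chart_at p; have pc : chart_dom c p by exact: chart_at_dom.
have [_ pis _ _] := pi_sub.
pose f b := gB b (Y b) (Z b).
have fs : smooth_fun f by exact: metric_smooth.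
have df := is_diff_pullback pis p fs.
have dphi : is_diff (c p) (phi \o chart_inv c) (@dfun R n M phi p).
  apply: differentiableP; apply: (smooth_fun_differentiable phi_smooth) => //.
  exact: chart_at_atlas.
have dexp := @is_diff_comp _ _ _ _ _ _ _ _ _ (is_diffZ 2 dphi)
  (is_diff_expR ((2 *: (phi \o chart_inv c)) (c p))).
have [_ E] := is_diffM dexp df.
have := congr1 (@^~ v) E.
rewrite /= chart_mapK// -/f => {}E.
apply: etrans E _.
rewrite /= !fctE /= (chart_mapK pc) vX /GRing.scale /= /f.
by ring.
Qed.

(** Both sides of the identity for [Dbar] are horizontal, and any horizontal
    vector [h] at [p] is the value of a lift [lift Y], so it is enough to pair
    both sides with all the [lift Y p]. In the duality of [D] and [Dbar] applied
    to lifts, the left side is given by [lie_metric_hlift] and the term in [D]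
    by the hypothesis; what remains, after the duality of [Ds] and [Dsbar], is
    the term in [Dbar]. *)
Lemma conformal_dual (D Dbar : connection M) (Ds Dsbar : connection B) :
  dual_connection gM D Dbar -> dual_connection gB Ds Dsbar ->
  conformal_submersion_with_horizontal_distribution gM pi phi D Ds ->
  conformal_submersion_with_horizontal_distribution gM pi phi Dbar Dsbar.
Proof.
move=> dM dB hD X Z Xs Zs p.
apply/eqP; rewrite -subr_eq0; apply/eqP.
apply: (horizontal_nondegenerate pi_split).
  apply: horizontalB.
    by case: (hprojP pi_split (Dbar (lift X) (lift Z) p)).
  apply: horizontalB.
    by apply: horizontalD; [apply: horizontalD|]; rewrite //;
      apply: horizontalZ.
  by apply: horizontalZ; case: (hprojP pi_split (grad gM phi p)).
move=> h hh.
have [Y Ys Yh] := vector_extension (dmap pi h).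
have {hh}-> : h = lift Y p by exact: (hlift_unique pi_sub pi_split).
have DsY := nabla_smooth Ds Xs Ys; have DsbarZ := nabla_smooth Dsbar Xs Zs.
have := dM _ _ _ (lift_smooth Xs) (lift_smooth Ys) (lift_smooth Zs) p.
rewrite lie_metric_hlift// (dB _ _ _ Xs Ys Zs)
  [gM p (D _ _ _) _]Defs.metric_sym.
(* Against a horizontal vector, [D (lift X) (lift Y)] and its horizontal
   projection pair equally, so the hypothesis [hD] applies. *)
rewrite -[gM p (lift Z p) (D _ _ _)](metric_hproj pi_split _
  (@lift_horizontal Z p)) hD//.
rewrite !(metricDr, metricNr, metricZr) 
  !(metric_hproj pi_split _ (@lift_horizontal _ p)).
rewrite !metric_hlift//.
rewrite ![gM p _ (grad _ _ _)]Defs.metric_sym !metric_grad -!/(lie _ _ _).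
rewrite !(Defs.metric_sym gB (Z (pi p)))
  !(Defs.metric_sym gB (Y (pi p)) (X (pi p))).
lra.
Qed.

End Duality.

(** This reduces the equivalence to one implication. *)
Lemma dual_connection_sym (R : realType) (n : nat) (M : manifold R n)
    (g : semi_riemannian_metric M) (D D' : connection M) :
  dual_connection g D D' -> dual_connection g D' D.
Proof.
move=> dD X Y Z Xs Ys Zs p.
under [X in lie _ X]eq_fun do rewrite Defs.metric_sym.
by rewrite dD// addrC; congr (_ + _); exact: Defs.metric_sym.
Qed.

Theorem proposition1 (R : realType) (n m : nat)
  (M : manifold R n) (B : manifold R m)
  (gM : semi_riemannian_metric M) (gB : semi_riemannian_metric B)
  (D Dbar : connection M) (Ds Dsbar : connection B)
  (pi : M -> B) (phi : M -> R)
  (hDbar : dual_connection gM D Dbar)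
  (hDsbar : dual_connection gB Ds Dsbar)
  (hpi : conformal_submersion gM gB pi phi) :
  conformal_submersion_with_horizontal_distribution gM pi phi D Ds <->
  conformal_submersion_with_horizontal_distribution gM pi phi Dbar Dsbar.
Proof.
split; first exact: conformal_dual hpi _ _ _ _ hDbar hDsbar.
exact: conformal_dual hpi _ _ _ _ (dual_connection_sym hDbar)
  (dual_connection_sym hDsbar).
Qed.
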